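(* For every indexed forest $F\in \mathsf{For}$ and every $i\ge 1$, $$\mathsf{T}_i\,\mathfrak{P}_F=\begin{cases}\mathfrak{P}_{F/i}&\text{if } i\in \mathrm{LTer}(F),\\ 0&\text{otherwise.}\end{cases}$$
   Context: $\mathbb{N}=\{1,2,\ldots\}$ and $\mathrm{Pol}=\mathbb{Z}[x_1,x_2,\ldots]$. For $i\ge 1$, $\mathsf{R}_i(f)=f(x_1,\ldots,x_{i-1},0,x_i,x_{i+1},\ldots)$ and $\mathsf{T}_i(f)=\frac{\mathsf{R}_{i+1}(f)-\mathsf{R}_i(f)}{x_i}$ for $f\in\mathrm{Pol}$. Forests: a binary tree is a finite rooted plane tree in which each node is either a leaf (no children) or internal, having an ordered pair of children $v_L,v_R$; $\ast$ is the tree with a single node (a leaf). An indexed forest is an infinite sequence $F=(T_1,T_2,\ldots)$ of binary trees, all but finitely many equal to $\ast$; $\mathsf{For}$ is the set of indexed forests. The leaves of $F$, read from left to right through $T_1,T_2,\ldots$, are identified with $1,2,3,\ldots$. $\mathrm{IN}(F)$ is the finite set of internal nodes. For $v\in \mathrm{IN}(F)$, $\rho_F(v)\in\mathbb{N}$ is the leaf reached from $v$ by repeatedly passing to the left child. A node $v\in\mathrm{IN}(F)$ is terminal if both its children are leaves, and $\mathrm{LTer}(F)=\{\rho_F(v): v\text{ terminal}\}$. If $i\in \mathrm{LTer}(F)$, the trimmed forest $F/i$ is obtained by deleting the two leaf children of the terminal node $v$ with $\rho_F(v)=i$, so that $v$ becomes a leaf (leaves are then relabelled from left to right). Forest polynomials: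 let $\mathcal{C}(F)$ be the set of $\kappa:\mathrm{IN}(F)\to\mathbb{N}$ such that for all $v\in \mathrm{IN}(F)$: $\kappa(v)\le\rho_F(v)$; if $v_L\in \mathrm{IN}(F)$ then $\kappa(v)\le\kappa(v_L)$; if $v_R\in \mathrm{IN}(F)$ then $\kappa(v)<\kappa(v_R)$. Then $\mathfrak{P}_F=\sum_{\kappa\in\mathcal{C}(F)}\prod_{v\in \mathrm{IN}(F)}x_{\kappa(v)}$. *)

(* Defs.v *)
From HB Require Import structures.
From mathcomp Require Import all_boot all_order all_algebra finmap.
From mathcomp.multinomials Require Import monalg.

Set Implicit Arguments.
Unset Strict Implicit.
Unset Printing Implicit Defensive.

Import GRing.Theory.
Local Open Scope ring_scope.

(* Z[x_1, x_2, ...]. Monomials have variables indexed by nat; index k stands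
   for x_{k+1}, so there is no variable x_0. *)
Notation Pol := {malg int[{cmonom nat}]}.

(* The variable x_i, meaningful for 1 <= i. *)
Definition x (i : nat) : Pol := << ucm i.-1 >>.

Definition meval (a : nat -> Pol) (m : {cmonom nat}) : Pol :=
  \prod_(k <- finsupp m) a k.+1 ^+ m k.

(* f(a_1, a_2, ...); a 0 is irrelevant. *)
Definition peval (a : nat -> Pol) (f : Pol) : Pol :=
  mmap (fun c : int => (c%:MP : Pol)) (meval a) f.

Definition R (i : nat) (f : Pol) : Pol :=
  peval (fun j => if (j < i)%N then x j else if j == i then 0 else x j.-1) f.

(* Exact division by x_i: terms not divisible by x_i are dropped. Only applied
   to multiples of x_i, see [divxK] and [x_mulT]. *)
Definition divx (i : nat) (f : Pol) : Pol :=
  \sum_(m <- msupp f | (0 < m i.-1)%N) << f@_m *g divcm m (ucm i.-1) >>.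

Definition T (i : nat) (f : Pol) : Pol := divx i (R i.+1 f - R i f).

Inductive btree : Type := Leaf | Node of btree & btree.

Fixpoint eqbtree (s t : btree) : bool :=
  match s, t with
  | Leaf, Leaf => true
  | Node s1 s2, Node t1 t2 => eqbtree s1 t1 && eqbtree s2 t2
  | _, _ => false
  end.

Lemma eqbtreeP : Equality.axiom eqbtree.
Proof.
elim=> [|s1 IH1 s2 IH2] [|t1 t2] /=; try by constructor.
by apply: (iffP andP) => [[/IH1-> /IH2->]|[<- <-]] //; split; [apply/IH1|apply/IH2].
Qed.

HB.instance Definition _ := hasDecEq.Build btree eqbtreeP.

(* Nodes of a tree are addressed by paths from the root: false goes to the left
   child, true to the right child. *)
Fixpoint internal (t : btree) : seq (seq bool) :=
  if t is Node l r
  then [::] :: map (cons false) (internal l) ++ map (cons true) (internal r)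
  else [::].

Fixpoint leaves (t : btree) : seq (seq bool) :=
  if t is Node l r
  then map (cons false) (leaves l) ++ map (cons true) (leaves r)
  else [:: [::]].

(* The subtree rooted at p (Leaf when p is not an address of t). *)
Fixpoint subtree (t : btree) (p : seq bool) : btree :=
  match p, t with
  | b :: p', Node l r => subtree (if b then r else l) p'
  | _ :: _, Leaf => Leaf
  | [::], _ => t
  end.

(* Replaces by a leaf the subtree rooted at p. *)
Fixpoint prune (t : btree) (p : seq bool) : btree :=
  match p, t with
  | b :: p', Node l r =>
      if b then Node l (prune r p') else Node (prune l p') r
  | _, _ => Leaf
  end.

(* Path from the root to the leaf reached by always going left. *)
Fixpoint lspine (t : btree) : seq bool :=
  if t is Node l _ then false :: lspine l else [::].

(* F : For is the sequence (T_1, T_2, ...) with T_{k+1} = F k. *)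
Definition For : Type := {fsfun nat -> btree with Leaf}.

(* (k, p) is the node at address p in the tree T_{k+1}. *)
Definition node : Type := (nat * seq bool)%type.

Definition lchild (v : node) : node := (v.1, rcons v.2 false).
Definition rchild (v : node) : node := (v.1, rcons v.2 true).

Definition inodes (F : For) : seq node :=
  [seq (k, p) | k <- finsupp F, p <- internal (F k)].

Notation IN F := (seq_sub (inodes F)).

(* The number, starting from 1, of a leaf in the left to right order. *)
Definition leafnum (F : For) (v : node) : nat :=
  (\sum_(j < v.1) size (leaves (F j)) + index v.2 (leaves (F v.1)) + 1)%N.

Definition rho (F : For) (v : node) : nat :=
  leafnum F (v.1, v.2 ++ lspine (subtree (F v.1) v.2)).

Definition terminal (F : For) (v : node) : bool :=
  subtree (F v.1) v.2 == Node Leaf Leaf.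

Definition LTer (F : For) : seq nat :=
  [seq rho F v | v <- inodes F & terminal F v].

(* F/i for i in LTer F (F itself otherwise). The node picked is unique, see
   [terminal_rho_inj]. *)
Definition trim (F : For) (i : nat) : For :=
  if [pick v : IN F | terminal F (val v) && (rho F (val v) == i)] is Some v
  then [fsfun F with (val v).1 |-> prune (F (val v).1) (val v).2]
  else F.

Definition compatible (F : For) (kappa : IN F -> nat) : bool :=
  [forall v : IN F,
    [&& (0 < kappa v <= rho F (val v))%N,
        [forall w : IN F, (val w == lchild (val v)) ==> (kappa v <= kappa w)%N]
      & [forall w : IN F, (val w == rchild (val v)) ==> (kappa v < kappa w)%N]]].

Definition rho_max (F : For) : nat := \max_(v : IN F) rho F (val v).

(* C(F). The finite codomain is no restriction, see [compatible_le]. *)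
Definition C (F : For) : {set {ffun IN F -> 'I_(rho_max F).+1}} :=
  [set kappa : {ffun IN F -> 'I_(rho_max F).+1} |
     compatible (fun v => val (kappa v))].

Definition forest_poly (F : For) : Pol :=
  \sum_(kappa in C F) \prod_(v : IN F) x (kappa v).

Lemma mevalEw a (d : {fset nat}) (m : {cmonom nat}) :
  (finsupp m `<=` d)%fset -> meval a m = \prod_(k <- d) a k.+1 ^+ m k.
Proof.
move=> le; rewrite /meval (big_fset_incl _ le) // => k _.
by rewrite -cmE_eq0 => /eqP->; rewrite expr0.
Qed.

Lemma meval_mmorphism a : mmorphism (meval a).
Proof.
split=> [m1 m2|]; last by rewrite /meval mdom1 big_seq_fset0.
pose d := (finsupp m1 `|` finsupp m2)%fset.
rewrite !(@mevalEw a d) ?mdomD ?fsubsetUl ?fsubsetUr //.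
by rewrite -big_split; apply: eq_bigr => k _; rewrite cmM exprD.
Qed.

HB.instance Definition _ a := isMultiplicative.Build _ _ (meval a)
  (meval_mmorphism a).
HB.instance Definition _ a := GRing.RMorphism.copy (peval a)
  (mmap (@malgC {cmonom nat} int) (meval a)).

Lemma peval_x a i : (0 < i)%N -> peval a (x i) = a i.
Proof.
case: i => // i _; rewrite /peval mmapU /= /meval mdomU big_seq_fset1 cmUU.
by rewrite expr1 rmorph1 mul1r.
Qed.

HB.instance Definition _ i := GRing.RMorphism.copy (R i)
  (peval (fun j => if (j < i)%N then x j else if j == i then 0 else x j.-1)).

Lemma mcoeff_xM i f m : (x i * f)@_(mulcm (ucm i.-1) m) = f@_m.
Proof.
rewrite (mcoeffMlw (d1 := [fset ucm i.-1]%fset) (d2 := (m |` msupp f)%fset));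
  last 2 first.
- exact: msuppU_le.
- exact: fsubsetU1.
rewrite big_seq_fset1 mcoeffUU (big_fsetD1 m) ?in_fsetE ?eqxx //=.
rewrite mul1r big1_fset ?addr0 // => k.
rewrite in_fsetD1 => /andP[km _] _; case: eqP => // /eqP/cmP ek.
case/eqP: km; apply/eqP/cmP => j; have := ek j.
by rewrite !mulcmE => /addnI.
Qed.

Lemma mcoeff_divx i f m : (divx i f)@_m = f@_(mulcm (ucm i.-1) m).
Proof.
set u := ucm i.-1; rewrite /divx raddf_sum /=.
under eq_bigr do rewrite mcoeffU.
have divK (m' : {cmonom nat}) :
    (0 < m' i.-1)%N -> (divcm m' u == m) = (m' == mulcm u m).
  move=> m'0; apply/eqP/eqP => [<-|->]; apply/eqP/cmP => k.
    by rewrite mulcmE divcmE subnKC // ucmE; case: eqP => // <-.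
  by rewrite divcmE mulcmE addKn.
have u0 : (0 < mulcm u m i.-1)%N by rewrite mulcmE ucmE eqxx.
case: (boolP (mulcm u m \in msupp f)) => h.
  rewrite big_mkcond (big_fsetD1 _ h) u0 /= divK // eqxx mulr1n.
  rewrite big1_fset ?addr0 // => k; rewrite in_fsetD1 => /andP[nk _] _.
  by case: ifP => // k0; rewrite divK // (negbTE nk).
rewrite (mcoeff_outdom h) big1_fset // => k kf k0; rewrite divK //.
by case: eqP => // ek; rewrite ek (negbTE h) in kf.
Qed.

Lemma divxK i f : divx i (x i * f) = f.
Proof. by apply/malgP=> m; rewrite mcoeff_divx mcoeff_xM. Qed.

Lemma congrM (A : comPzRingType) (y p1 p2 q1 q2 : A) :
  (exists g, p1 - q1 = y * g) -> (exists g, p2 - q2 = y * g) ->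
  exists g, p1 * p2 - q1 * q2 = y * g.
Proof.
move=> [g1 e1] [g2 e2]; exists (g1 * p2 + q1 * g2).
by rewrite mulrDr mulrA -e1 (mulrCA y) -e2 mulrBl mulrBr addrA addrNK.
Qed.

Lemma peval_congr (y : Pol) (a b : nat -> Pol) :
  (forall j, (0 < j)%N -> exists g, a j - b j = y * g) ->
  forall f, exists g, peval a f - peval b f = y * g.
Proof.
move=> ab f; pose K p q := exists g, p - q = y * g.
have K0 p : K p p by exists 0; rewrite subrr mulr0.
have KD p1 p2 q1 q2 : K p1 q1 -> K p2 q2 -> K (p1 + p2) (q1 + q2).
  by move=> [g1 e1] [g2 e2]; exists (g1 + g2); rewrite mulrDr -e1 -e2 opprD addrACA.
have KM p1 p2 q1 q2 : K p1 q1 -> K p2 q2 -> K (p1 * p2) (q1 * q2).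
  exact: congrM.
change (K (peval a f) (peval b f)).
rewrite /peval /mmap; apply: (big_rec2 K); first exact: K0.
move=> m p q _ Kpq; apply: (KD _ _ _ _ _ Kpq); apply: (KM _ _ _ _ (K0 _)).
rewrite /meval; apply: (big_rec2 K); first exact: K0.
move=> k p' q' _ Kpq'; apply: (KM _ _ _ _ _ Kpq').
elim: (m k) => [|n IH]; first by rewrite !expr0; exact: K0.
by rewrite !exprS; apply: (KM _ _ _ _ _ IH); apply: ab.
Qed.

Lemma x_mulT i f : (0 < i)%N -> x i * T i f = R i.+1 f - R i f.
Proof.
move=> i0; pose a n j := if (j < n)%N then x j else if j == n then 0 else x j.-1.
have [|g e] := @peval_congr (x i) (a i.+1) (a i) _ f.
  move=> j j0; rewrite /a; case: (ltngtP j i) => [ji|ij|->].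
  - by rewrite ltnS (ltnW ji); exists 0; rewrite subrr mulr0.
  - rewrite ltnNge ij /=; case: (eqVneq j i.+1) => [->|_]; last first.
      by exists 0; rewrite subrr mulr0.
    by exists (-1); rewrite mulrN1 sub0r.
  - by rewrite ltnSn; exists 1; rewrite mulr1 subr0.
have {}e : R i.+1 f - R i f = x i * g by [].
by rewrite /T e divxK.
Qed.

Lemma compatible_le (F : For) (kappa : IN F -> nat) (v : IN F) :
  compatible kappa -> (kappa v < (rho_max F).+1)%N.
Proof.
move=> /forallP/(_ v)/and3P[/andP[_ le] _ _]; rewrite ltnS.
exact: leq_trans le (leq_bigmax v).
Qed.

Lemma mem_leaves_spine t p q :
  subtree t p = Node Leaf Leaf -> rcons p q \in leaves t.
Proof.
elim: t p => [|l IHl r IHr] [|b p] //=.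
  by case=> -> -> /=; case: (q); rewrite !inE.
by case: b => [/IHr|/IHl] h; rewrite mem_cat map_f ?orbT.
Qed.

Lemma leafnum_inj (F : For) v w :
  v.2 \in leaves (F v.1) -> w.2 \in leaves (F w.1) ->
  leafnum F v = leafnum F w -> v = w.
Proof.
wlog le : v w / (v.1 <= w.1)%N.
  move=> H hv hw e; case: (leqP v.1 w.1) => [|/ltnW] /H; first exact.
  by move=> /(_ hw hv (esym e)) ->.
case: v w le => [k p] [l q] /= le hp hq /addIn; move: le.
rewrite leq_eqVlt => /orP[/eqP e|lt].
  by move: hq; rewrite /= -e => hq /addnI /= epq; rewrite (index_inj p hp hq epq).
move=> /eqP; rewrite ltn_eqF //; apply: leq_trans (leq_addr _ _).
have : (\sum_(j < k.+1) size (leaves (F j)) <=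
        \sum_(j < l) size (leaves (F j)))%N.
  rewrite -!(big_mkord xpredT (fun j => size (leaves (F j)))).
  by rewrite [X in (_ <= X)%N](big_cat_nat (n := k.+1)) //= leq_addr.
by apply: leq_trans; rewrite big_ord_recr /= ltn_add2l index_mem.
Qed.

Lemma terminal_rho_inj (F : For) v w :
  terminal F v -> terminal F w -> rho F v = rho F w -> v = w.
Proof.
case: v w => [k p] [l q] /eqP /= tv /eqP /= tw.
rewrite /rho /= tv tw /= !cats1 => /leafnum_inj /=.
by move=> /(_ (mem_leaves_spine _ tv) (mem_leaves_spine _ tw))[-> /rcons_inj[->]].
Qed.

(* Main.v *)
Require Import Defs.
From mathcomp Require Import all_boot all_order all_algebra finmap.
From mathcomp Require Import zify.
From mathcomp.multinomials Require Import monalg.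

(** The forest polynomial counts increasing labelings of the internal nodes,
    the label of a node being at most the number of its leftmost leaf. Allow
    instead an arbitrary bound for each leaf. Then [R_i] maps the
    polynomial of a forest to the polynomial of the same forest with other
    bounds ([rmorph_tree_poly]): setting [x_i] to 0 forbids the label [i], and
    shifting the larger variables closes the gap that this leaves among the
    labels. A bound [m] stays [m] if [m < i] and becomes [m - 1] otherwise.

    Comparing [R_i] and [R_(i+1)], the bounds differ only at the leaf [i], where
    they are [i - 1] and [i]. Therefore [R_(i+1) P_F - R_i P_F] counts the
    labelings for the second bounds in which a node with leftmost leaf [i] is
    labelled [i]. Labels weakly increase along left edges, so the lowest node
    with leftmost leaf [i] is labelled [i]. A right child of it that is internal
    would have leftmost leaf [i + 1], hence bound [i], and a label greater
    than [i], which is absurd; so this lowest node is terminal, that is, [i] is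
    in LTer(F). Deleting it removes the factor [x_i], and the bounds that remain
    are the leaf numbers of F/i. This is [tree_poly_step], proved by induction on
    a single tree.

    The induction needs a recursive description of the polynomial.
    [forest_polyE] provides it: P_F is a product over the trees of F, and the
    polynomial of a tree is a sum over the label of its root of products of the
    polynomials of the two subtrees. At most one tree contains the leaf [i], so
    the other factors of the two products agree, and they are the factors of
    P_(F/i). *)

Set Implicit Arguments.
Unset Strict Implicit.
Unset Printing Implicit Defensive.

Import GRing.Theory.
Local Open Scope ring_scope.

(** * The polynomial of a tree with general bounds *)

Notation nleaves t := (size (leaves t)).

(** The generating function of the labelings of [t] with root label at least
    [b], increasing as in C(F), when the leftmost leaf of [t] is numbered [n].
    The bound on the label of a node is [bnd] of its leftmost leaf rather than
    that leaf itself: substitutions act on the polynomial only by changing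
    [bnd], so the family of all [tree_poly] is stable under them. *)
Fixpoint tree_poly (A : comNzRingType) (w : nat -> A) (bnd : nat -> nat)
    (t : btree) (n b : nat) : A :=
  if t is Node l r then
    \sum_(b <= k < (bnd n).+1)
       w k * (tree_poly w bnd l n k * tree_poly w bnd r (n + nleaves l)%N k.+1)
  else 1.

Lemma nleaves_gt0 t : (0 < nleaves t)%N.
Proof. by elim: t => //= l IHl r _; rewrite size_cat !size_map addn_gt0 IHl. Qed.

(** The polynomial sees leaf numbers only through their bounds, so renumbering
    the leaves and changing the bounds can compensate each other. *)
Lemma eq_tree_poly (A : comNzRingType) (w : nat -> A) bnd bnd' t n n' b :
  (forall j, (j < nleaves t)%N -> bnd (n + j)%N = bnd' (n' + j)%N) ->
  tree_poly w bnd t n b = tree_poly w bnd' t n' b.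
Proof.
elim: t n n' b => [|l IHl r IHr] n n' b //=; rewrite size_cat !size_map => e.
have := e 0%N (ltn_addr _ (nleaves_gt0 l)); rewrite !addn0 => ->.
apply: eq_bigr => k _; congr (_ * (_ * _)).
  by apply: IHl => j lt; apply: e; apply: ltn_addr.
by apply: IHr => j lt; rewrite -!addnA; apply: e; rewrite ltn_add2l.
Qed.

(** The largest integer at most [m] and different from [i], after closing the
    gap that the removal of [i] leaves: this is what becomes of an upper bound
    [m] when the label [i] is forbidden. A lower bound [b] becomes
    [squash i.+1 b]. *)
Definition squash (i m : nat) : nat := if (m < i)%N then m else m.-1.

Lemma sum_squash (A : comNzRingType) (g h : nat -> A) i b c :
  (0 < i)%N -> (0 < b)%N ->
  (forall k, (0 < k)%N ->
     h k = if (k < i)%N then g k else if k == i then 0 else g k.-1) ->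
  \sum_(b <= k < c.+1) h k =
  \sum_(squash i.+1 b <= k < (squash i c).+1) g k.
Proof.
move=> i0 b0 hE; rewrite /squash; elim: c => [|c IH].
  by rewrite !big_geq //; do ?case: ifP; lia.
case: (leqP b c.+1) => [le|gt]; last by rewrite !big_geq //; do ?case: ifP; lia.
rewrite big_nat_recr //= IH hE //.
case: (ltngtP c.+1 i) => [lt|gt|e].
- by rewrite [in RHS]big_nat_recr //=; case: ifP; lia.
- case: c gt {IH} le => [|c] gt le; first by lia.
  by rewrite [in RHS]big_nat_recr //=; case: ifP; lia.
- by rewrite addr0.
Qed.

(** A morphism that acts on the variables like R_i kills the labelings using the
    label [i] and shifts down the labels above it. As the integers other than
    [i] are order isomorphic to all the integers, the surviving labelings are
    again the increasing ones, with bounds changed by [squash i]. *)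
Lemma rmorph_tree_poly (A B : comNzRingType) (phi : {rmorphism A -> B})
    (v : nat -> A) (w : nat -> B) i t n b : (0 < i)%N -> (0 < b)%N ->
  (forall k, (0 < k)%N -> phi (v k) =
     if (k < i)%N then w k else if k == i then 0 else w k.-1) ->
  phi (tree_poly v id t n b) = tree_poly w (squash i) t n (squash i.+1 b).
Proof.
move=> i0 b0 phiE; elim: t n b b0 => [|l IHl r IHr] n b b0 /=.
  by rewrite rmorph1.
rewrite rmorph_sum /= big_nat.
under eq_bigr => k /andP[lek _].
  have k0 : (0 < k)%N by apply: leq_trans lek.
  rewrite !rmorphM /= IHl // IHr // phiE //; over.
rewrite -big_nat; apply: sum_squash => // k k0.
rewrite /squash; case: (ltngtP k i) => [lt|gt|->].
- by rewrite !ltnS (ltnW lt) lt.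
- by rewrite !ltnS leqNgt gt /= ltnNge (ltnW gt) /= prednK.
- by rewrite mul0r.
Qed.

(** * Raising the bound of one leaf *)

(** The address of the terminal node of [t] whose left child is the leaf number
    [m], leaves being counted from 0. The tree [Node Leaf Leaf] is the only one
    in which the recursion has to stop above the leaf. *)
Fixpoint terminal_at (t : btree) (m : nat) : option (seq bool) :=
  if t is Node l r then
    if [&& l == Leaf, r == Leaf & m == 0%N] then Some [::]
    else if (m < nleaves l)%N then omap (cons false) (terminal_at l m)
    else omap (cons true) (terminal_at r (m - nleaves l)%N)
  else None.

Lemma index_map_cons b b' (p : seq bool) s :
  index (b :: p) (map (cons b') s) = if b == b' then index p s else size s.
Proof.
elim: s => [|q s IH] /=; first by rewrite if_same.
by rewrite eqseq_cons (eq_sym b') IH; case: (b == b').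
Qed.

Lemma index_leaves b p l r :
  index (b :: p) (leaves (Node l r)) =
  if b then (nleaves l + index p (leaves r))%N else
  if p \in leaves l then index p (leaves l) else (nleaves l + nleaves r)%N.
Proof.
rewrite /= index_cat !index_map_cons size_map.
have mE : (b :: p \in map (cons false) (leaves l)) = ~~ b && (p \in leaves l).
  case: b => /=; first by apply/mapP => -[].
  by rewrite mem_map // => ? ? [].
rewrite mE; case: b {mE} => //=; by case: ifP.
Qed.

Lemma terminal_atP t m p :
  terminal_at t m = Some p <->
  subtree t p = Node Leaf Leaf /\ index (rcons p false) (leaves t) = m.
Proof.
elim: t m p => [|l IHl r IHr] m p; first by split=> //; case: p => [|? ?] [].
rewrite [terminal_at _ _]/=; case: ifP => [/and3P[/eqP-> /eqP-> /eqP->]|ne].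
  split=> [[<-] //|]; case: p => [|[] [|? ?]] [] //.
have ne' : subtree (Node l r) [::] = Node Leaf Leaf ->
   index [:: false] (leaves (Node l r)) = m -> False.
  by case=> el er /= em; move: ne em; rewrite el er /= => + em; rewrite -em.
split.
  case: ltnP => lt; [case E: terminal_at => [q|] // | case E: terminal_at => [q|] //].
    move=> [<-]; have [h1 h2] := (IHl _ _).1 E; split=> //.
    by rewrite rcons_cons index_leaves mem_leaves_spine.
  move=> [<-]; have [h1 h2] := (IHr _ _).1 E; split=> //.
  by rewrite rcons_cons index_leaves h2 subnKC.
case: p => [|b p] []; first by move=> h1 h2; case: (ne' h1 h2).
rewrite rcons_cons index_leaves /=; case: b => h <-.
  rewrite ltnNge leq_addr /= addKn.
  by have -> := (IHr (index (rcons p false) (leaves r)) p).2 (conj h erefl).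
rewrite mem_leaves_spine // index_mem mem_leaves_spine //.
by have -> := (IHl (index (rcons p false) (leaves l)) p).2 (conj h erefl).
Qed.

Lemma nleaves_prune t p : subtree t p = Node Leaf Leaf ->
  nleaves t = (nleaves (prune t p)).+1.
Proof.
elim: t p => [|l IHl r IHr] [|b p] //=; first by case=> -> ->.
by case: b => /= [/IHr|/IHl] e; rewrite !size_cat !size_map e ?addnS.
Qed.

(** The combinatorial heart. The bounds [squash i.+1] and [squash i] differ at
    the leaf [i] only, where they are [i] and [i - 1]. So the difference counts
    the labelings in which some node above leaf [i] along left edges is labelled
    [i], and the lowest such node is then labelled [i] too. Its right child, if
    internal, would need a label larger than [i] while its bound is [i]: hence
    the node is terminal. Removing it gives a factor [w i] and leaves a
    labeling of the pruned tree, in which leaf [i] has bound [i] and the later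
    leaves, renumbered, have their own number as a bound. *)
Lemma tree_poly_step (A : comNzRingType) (w : nat -> A) i t n b : (0 < i)%N ->
  (n <= i)%N -> (b <= i)%N ->
  tree_poly w (squash i.+1) t n b =
  tree_poly w (squash i) t n b +
  (if terminal_at t (i - n)%N is Some p then w i * tree_poly w id (prune t p) n b
   else 0).
Proof.
move=> i_gt0; elim: t n b => [|l IHl r IHr] n b ni bi; first by rewrite addr0.
(* Left of leaf i no bound changes; right of it the numbers drop by one. *)
have before s m c : (m + nleaves s <= i)%N ->
    tree_poly w (squash i.+1) s m c = tree_poly w id s m c /\
    tree_poly w (squash i) s m c = tree_poly w id s m c.
  by move=> le; split; apply: eq_tree_poly => j lt; rewrite /squash; case: ifP; lia.
have after s m m' c : (i < m)%N -> m = m'.+1 ->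
    tree_poly w (squash i.+1) s m c = tree_poly w id s m' c /\
    tree_poly w (squash i) s m c = tree_poly w id s m' c.
  by move=> le e; split; apply: eq_tree_poly => j lt; rewrite /squash; case: ifP; lia.
have l0 := nleaves_gt0 l.
move: ni; rewrite leq_eqVlt => /orP[/eqP e|lt].
  subst n; rewrite subnn.
  have si : squash i.+1 i = i by rewrite /squash ltnSn.
  have si' : squash i i = i.-1 by rewrite /squash ltnn.
  have rE c : tree_poly w (squash i.+1) r (i + nleaves l)%N c =
      tree_poly w (squash i) r (i + nleaves l)%N c.
    have e : (i + nleaves l = (i + nleaves l).-1.+1)%N by lia.
    by rewrite (after _ _ _ _ _ e).1 ?(after _ _ _ _ _ e).2 //; lia.
  (* The leaf i is the leftmost one: the root may take the extra label i. *)
  have -> : tree_poly w (squash i.+1) (Node l r) i b =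
      \sum_(b <= k < i) w k * (tree_poly w (squash i.+1) l i k *
         tree_poly w (squash i) r (i + nleaves l)%N k.+1) +
      w i * (tree_poly w (squash i.+1) l i i *
         tree_poly w (squash i) r (i + nleaves l)%N i.+1).
    rewrite /= si big_nat_recr //= rE; congr (_ + _).
    by apply: eq_bigr => k _; rewrite rE.
  have -> : tree_poly w (squash i) (Node l r) i b =
      \sum_(b <= k < i) w k * (tree_poly w (squash i) l i k *
         tree_poly w (squash i) r (i + nleaves l)%N k.+1).
    by rewrite /= si' prednK.
  case: l IHl l0 rE => [|l1 l2] IHl l0 rE.
    (* The root is the lowest node above leaf i; if r is internal, its labels
       range from i + 1 to i. *)
    case: r {IHr rE} => [|r1 r2]; first by rewrite /= !mulr1.
    rewrite /= [X in w i * (_ * X)]big_geq ?mulr0 //.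
    by rewrite /squash; case: ifP; lia.
  set l := Node l1 l2 in IHl l0 rE *.
  have IH k : (k <= i)%N -> tree_poly w (squash i.+1) l i k =
      tree_poly w (squash i) l i k +
      if terminal_at l 0%N is Some p then w i * tree_poly w id (prune l p) i k
      else 0.
    by move=> ki; rewrite (IHl i k (leqnn i) ki) subnn.
  (* With bound i - 1 on the root of l, no label is at least i. *)
  have l_i : tree_poly w (squash i) l i i = 0.
    by rewrite /= si' prednK // big_geq.
  have -> : terminal_at (Node l r) 0%N = omap (cons false) (terminal_at l 0%N).
    by rewrite [LHS]/= l0.
  rewrite IH // l_i add0r.
  under eq_big_nat => k /andP[_ ki] do rewrite (IH _ (ltnW ki)).
  case E: (terminal_at l 0%N) => [p|] /=.
    have sz := nleaves_prune ((terminal_atP _ _ _).1 E).1.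
    rewrite big_nat_recr //= mulrDr addrA mulr_sumr -big_split /=.
    have e : (i + nleaves l = (i + nleaves (prune l p)).+1)%N by lia.
    have rP c := (after r _ _ c _ e).2.
    rewrite rP; last by lia.
    congr (_ + _); last by rewrite !mulrA.
    apply: eq_bigr => k _; rewrite rP; last by lia.
    by rewrite mulrDl mulrDr; congr (_ + _); rewrite !mulrA (mulrC (w k)).
  rewrite mul0r mulr0; congr (_ + _).
  by apply: eq_bigr => k _; rewrite addr0.
(* The leaf i is further right: the root is unaffected, and the difference
   comes from the child whose leaves contain i. *)
have sn : squash i.+1 n = n by rewrite /squash ltnS (ltnW lt).
have sn' : squash i n = n by rewrite /squash lt.
have ne : [&& l == Leaf, r == Leaf & (i - n)%N == 0%N] = false by lia.
rewrite [terminal_at _ _]/= ne [LHS]/= sn.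
have -> : tree_poly w (squash i) (Node l r) n b =
      \sum_(b <= k < n.+1) w k * (tree_poly w (squash i) l n k *
         tree_poly w (squash i) r (n + nleaves l)%N k.+1).
  by rewrite /= sn'.
case: ltnP => [ltl|lel].
  have rE c : tree_poly w (squash i.+1) r (n + nleaves l)%N c =
      tree_poly w (squash i) r (n + nleaves l)%N c.
    have e : (n + nleaves l = (n + nleaves l).-1.+1)%N by lia.
    by rewrite (after _ _ _ _ _ e).1 ?(after _ _ _ _ _ e).2 //; lia.
  under eq_big_nat => k /andP[_ kn].
    have ki : (k <= i)%N by lia.
    rewrite rE (IHl _ _ (ltnW lt) ki). over.
  case E: (terminal_at l (i - n)%N) => [p|] /=; last first.
    by rewrite addr0; apply: eq_bigr => k _; rewrite addr0.
  have sz := nleaves_prune ((terminal_atP _ _ _).1 E).1.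
  rewrite mulr_sumr -big_split /=; apply: eq_bigr => k _.
  have e : (n + nleaves l = (n + nleaves (prune l p)).+1)%N by lia.
  have rP c := (after r _ _ c _ e).2.
  rewrite rP; last by lia.
  by rewrite mulrDl mulrDr; congr (_ + _); rewrite !mulrA (mulrC (w k)).
under eq_big_nat => k /andP[_ kn].
  have ki : (k < i)%N by lia.
  have nl : (n + nleaves l <= i)%N by lia.
  rewrite (before l n k nl).1 (IHr _ _ nl ki). over.
under [X in _ = X + _]eq_big_nat => k /andP[_ kn].
  have nl : (n + nleaves l <= i)%N by lia.
  rewrite (before l n k nl).2. over.
rewrite -subnDA.
case E: (terminal_at r _) => [p|] /=; last first.
  by rewrite addr0; apply: eq_bigr => k _; rewrite addr0.
rewrite mulr_sumr -big_split /=; apply: eq_bigr => k _.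
by rewrite !mulrDr [in RHS](mulrCA (w i)); congr (_ + _ * _); apply: mulrCA.
Qed.

(** * Sums over labelings as iterated sums *)

(** Evaluating at elements of the ambient type makes the nodes of a subtree nodes of
    the forest, without any transport between finite types. *)
Definition label (V : choiceType) (s0 : seq V) (M : nat)
    (f : {ffun seq_sub s0 -> 'I_M.+1}) (u : V) : nat :=
  if insub u is Some w then val (f w) else 0%N.

Definition relabel (V : choiceType) (s0 : seq V) (M : nat)
    (f : {ffun seq_sub s0 -> 'I_M.+1}) (u : V) (k : 'I_M.+1) :
    {ffun seq_sub s0 -> 'I_M.+1} :=
  [ffun w => if val w == u then k else f w].

Lemma label_val (V : choiceType) (s0 : seq V) M
    (f : {ffun seq_sub s0 -> 'I_M.+1}) w : label f (val w) = f w.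
Proof. by rewrite /label valK. Qed.

Lemma label_relabel (V : choiceType) (s0 : seq V) M
    (f : {ffun seq_sub s0 -> 'I_M.+1}) u k u' : u \in s0 ->
  label (relabel f u k) u' = if u' == u then val k else label f u'.
Proof.
rewrite /label => us; case: insubP => [w _ <-|]; first by rewrite ffunE; case: ifP.
by case: eqP => // ->; rewrite us.
Qed.

(** The sum of [G] over all ways to change [h] on the entries of [s], organised
    as an iterated sum so that it follows the recursive structure of trees. *)
Fixpoint label_sum (A : comNzRingType) (V : choiceType) (s0 : seq V) (M : nat)
    (s : seq V) (G : {ffun seq_sub s0 -> 'I_M.+1} -> A)
    (h : {ffun seq_sub s0 -> 'I_M.+1}) : A :=
  if s is u :: s' then \sum_k label_sum s' G (relabel h u k) else G h.

Lemma label_sumE (A : comNzRingType) (V : choiceType) (s0 : seq V) M s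
    (G : {ffun seq_sub s0 -> 'I_M.+1} -> A) h :
  uniq s -> {subset s <= s0} ->
  label_sum s G h =
  \sum_(f : {ffun seq_sub s0 -> 'I_M.+1} |
     [forall w, (val w \in s) || (f w == h w)]) G f.
Proof.
elim: s h => [|u s IH] h /=.
  move=> _ _; rewrite (big_pred1 h) // => f /=.
  apply/forallP/eqP => [e|-> //]; apply/ffunP => w.
  exact/eqP/e.
move=> /andP[us uq] sub.
have u0 : u \in s0 by apply: sub; rewrite inE eqxx.
rewrite [RHS](partition_big (fun f : {ffun _ -> _} => f (SeqSub u0)) xpredT) //=.
apply: eq_bigr => k _; rewrite IH //; last first.
  by move=> v vs; apply: sub; rewrite inE vs orbT.
apply: eq_bigl => f; apply/forallP/andP => [e|[/forallP e /eqP fk] w].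
  split; last first.
    by have := e (SeqSub u0); rewrite /= (negbTE us) ffunE /= eqxx.
  apply/forallP => w; have := e w; rewrite inE ffunE.
  by case: (eqVneq (val w) u).
have := e w; rewrite ffunE inE; case: (eqVneq (val w) u) => //= wu _.
by rewrite -fk; apply/orP; right; apply/eqP; congr (f _); apply/val_inj.
Qed.

Lemma label_sum_all (A : comNzRingType) (V : choiceType) (s0 : seq V) M
    (G : {ffun seq_sub s0 -> 'I_M.+1} -> A) h :
  uniq s0 -> label_sum s0 G h = \sum_f G f.
Proof.
move=> uq; rewrite label_sumE //; apply: eq_bigl => f.
by apply/forallP => w; rewrite (ssvalP w).
Qed.

Lemma eq_label_sum (A : comNzRingType) (V : choiceType) (s0 : seq V) M s
    (G G' : {ffun seq_sub s0 -> 'I_M.+1} -> A) h : {subset s <= s0} ->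
  (forall f, (forall u, u \notin s -> label f u = label h u) -> G f = G' f) ->
  label_sum s G h = label_sum s G' h.
Proof.
elim: s h => [|u s IH] h sub e /=; first by apply: e.
apply: eq_bigr => k _; apply: IH => [v vs|f ef].
  by apply: sub; rewrite inE vs orbT.
apply: e => v; rewrite inE negb_or => /andP[vu vs].
by rewrite ef // label_relabel ?sub ?inE ?eqxx // (negbTE vu).
Qed.

Lemma label_sumZ (A : comNzRingType) (V : choiceType) (s0 : seq V) M s a
    (G : {ffun seq_sub s0 -> 'I_M.+1} -> A) h :
  label_sum s (fun f => a * G f) h = a * label_sum s G h.
Proof.
elim: s h => //= u s IH h; rewrite mulr_sumr.
by apply: eq_bigr => k _; rewrite IH.
Qed.

Definition blind (A : Type) (V : choiceType) (s0 : seq V) (M : nat)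
    (G : {ffun seq_sub s0 -> 'I_M.+1} -> A) (u : V) : Prop :=
  forall f k, G (relabel f u k) = G f.

Lemma label_sum_blind (A : comNzRingType) (V : choiceType) (s0 : seq V) M s
    (G : {ffun seq_sub s0 -> 'I_M.+1} -> A) u :
  blind G u -> blind (label_sum s G) u.
Proof.
move=> bl; elim: s => [|v s IH] h k /=; first exact: bl.
apply: eq_bigr => j _; have [->|vu] := eqVneq v u.
  by congr label_sum; apply/ffunP => w; rewrite !ffunE; case: eqP.
rewrite -[in RHS](IH _ k); congr label_sum; apply/ffunP => w; rewrite !ffunE.
by case: eqP => // ->; rewrite (negbTE vu).
Qed.

(** * Nodes and leaves of subtrees *)

Definition nodes_at (t : btree) (v : node) : seq node :=
  [seq (v.1, v.2 ++ p) | p <- internal t].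

Lemma nodes_atN l r v :
  nodes_at (Node l r) v = v :: nodes_at l (lchild v) ++ nodes_at r (rchild v).
Proof.
case: v => k q; rewrite /nodes_at /= cats0 map_cat -!map_comp.
by congr (_ :: _ ++ _); apply: eq_map => p /=; rewrite cat_rcons.
Qed.

Lemma uniq_internal t : uniq (internal t).
Proof.
have inj b : injective (cons b : seq bool -> seq bool) by move=> p q [].
elim: t => //= l IHl r IHr; rewrite cat_uniq !map_inj_uniq // IHl IHr andbT /=.
rewrite mem_cat negb_or; apply/andP; split.
  by apply/andP; split; apply/mapP => -[].
by apply/hasPn => _ /mapP[p _ ->]; apply/mapP => -[].
Qed.

Lemma mem_internal t p : (p \in internal t) = (subtree t p != Leaf).
Proof.
elim: t p => [|l IHl r IHr] [|b p] //=; rewrite inE mem_cat /=.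
have inj b' : injective (cons b' : seq bool -> seq bool) by move=> ? ? [].
have ne b' s : b' != b -> (b :: p \in map (cons b') s) = false.
  by move=> nb; apply/mapP => -[q _ [bb]]; rewrite bb eqxx in nb.
by case: b ne => ne; [rewrite (ne false)|rewrite (ne true)] => //;
  rewrite mem_map // ?orbF -?IHl -?IHr.
Qed.

Lemma mem_inodes (F : For) v : (v \in inodes F) = (subtree (F v.1) v.2 != Leaf).
Proof.
apply/allpairsPdep/idP => [[k [p [_ h ->]]]|h]; first by rewrite -mem_internal.
exists v.1, v.2; rewrite mem_internal h; split=> //; last by case: (v).
rewrite mem_finsupp; apply: contraNneq h => ->.
by case: (v.2).
Qed.

Lemma uniq_inodes (F : For) : uniq (inodes F).
Proof.
apply: allpairs_uniq_dep; rewrite ?fset_uniq //.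
- by move=> k _; apply: uniq_internal.
- by move=> [k p] [k' p'] _ _ [-> ->].
Qed.

Lemma subtree_cat t p q : subtree t (p ++ q) = subtree (subtree t p) q.
Proof.
elim: p t => [t|b p IH [|l r]]; [by case: t | by case: q {IH} | exact: IH].
Qed.

Lemma mem_leaves_cat t q p : subtree t q != Leaf ->
  p \in leaves (subtree t q) -> q ++ p \in leaves t.
Proof.
elim: t q => [|l IHl r IHr] [|b q] //=.
by case: b => ne h; rewrite mem_cat map_f ?orbT //; [apply: IHr|apply: IHl].
Qed.

(** The leaves below a node are consecutive: the constant is the number of leaves
    to their left. *)
Lemma index_leaves_cat t q : subtree t q != Leaf ->
  exists c, forall p, p \in leaves (subtree t q) ->
    index (q ++ p) (leaves t) = (c + index p (leaves (subtree t q)))%N.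
Proof.
elim: t q => [|l IHl r IHr] [|b q] //; first by exists 0%N.
rewrite [subtree _ _]/=; case: b => ne.
  have [c e] := IHr q ne; exists (nleaves l + c)%N => p h.
  by rewrite cat_cons index_leaves e // addnA.
have [c e] := IHl q ne; exists c => p h.
by rewrite cat_cons index_leaves e // mem_leaves_cat.
Qed.

Lemma mem_lspine t : lspine t \in leaves t.
Proof. by elim: t => //= l IH r _; rewrite mem_cat map_f. Qed.

Lemma index_lspine t : index (lspine t) (leaves t) = 0%N.
Proof.
elim: t => // l IH r _.
by rewrite [lspine _]/= index_leaves mem_lspine IH.
Qed.

Lemma subtree_nil t : subtree t [::] = t.
Proof. by case: t. Qed.

Lemma rho_root F k : rho F (k, [::]) = (\sum_(j < k) nleaves (F j) + 1)%N.
Proof. by rewrite /rho /leafnum /= subtree_nil index_lspine addn0. Qed.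

Lemma rho_lchild (F : For) v l r : subtree (F v.1) v.2 = Node l r ->
  rho F (lchild v) = rho F v.
Proof. by move=> e; rewrite /rho /= -cats1 subtree_cat e /= subtree_nil -catA. Qed.

Lemma rho_rchild (F : For) v l r : subtree (F v.1) v.2 = Node l r ->
  rho F (rchild v) = (rho F v + nleaves l)%N.
Proof.
move=> e; rewrite /rho /= -cats1 subtree_cat e /= subtree_nil -catA /leafnum /=.
have ne : subtree (F v.1) v.2 != Leaf by rewrite e.
have [c h] := index_leaves_cat ne; rewrite e in h.
rewrite !h ?mem_cat ?map_f ?mem_lspine ?orbT //.
rewrite !(index_leaves true) !(index_leaves false) mem_lspine !index_lspine.
lia.
Qed.

(** * The forest polynomial as a product over trees *)

(** The contribution of a single labeling to [tree_poly]: each edge condition is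
    checked through the lower bound handed to the child. *)
Fixpoint weight (A : comNzRingType) (w : nat -> A) (F : For) (t : btree)
    (v : node) (b : nat) (f : {ffun IN F -> 'I_(rho_max F).+1}) : A :=
  if t is Node l r then
    let k := label f v in
    if (b <= k <= rho F v)%N
    then w k * (weight w l (lchild v) k f * weight w r (rchild v) k.+1 f)
    else 0
  else 1.

Lemma blind_weight (A : comNzRingType) (w : nat -> A) (F : For) t v b u :
  u \in inodes F -> u \notin nodes_at t v -> blind (@weight A w F t v b) u.
Proof.
move=> uF; elim: t v b => [|l IHl r IHr] v b; first by move=> _ f k.
rewrite nodes_atN inE mem_cat !negb_or => /and3P[uv ul ur] f k /=.
by rewrite label_relabel // eq_sym (negbTE uv) IHl // IHr.
Qed.

Lemma sub_nodes_at (F : For) v t : subtree (F v.1) v.2 = t ->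
  {subset nodes_at t v <= inodes F}.
Proof.
by move=> e u /mapP[p]; rewrite mem_internal mem_inodes => h -> /=; rewrite subtree_cat e.
Qed.

(** Once the label of the root is fixed, the weights of the two subtrees involve
    disjoint sets of nodes and their sums separate. The factor [G] carries the
    rest of the forest through the induction. *)
Lemma label_sum_tree (A : comNzRingType) (w : nat -> A) (F : For) t v b s G h :
  subtree (F v.1) v.2 = t -> uniq (nodes_at t v ++ s) ->
  {subset s <= inodes F} -> (forall u, u \in nodes_at t v -> blind G u) ->
  label_sum (nodes_at t v ++ s) (fun f => @weight A w F t v b f * G f) h =
  tree_poly w id t (rho F v) b * label_sum s G h.
Proof.
elim: t v b s G h => [|l IHl r IHr] v b s G h e uq sub bl.
  by rewrite label_sumZ.
have vF : v \in inodes F by rewrite mem_inodes e.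
have el : subtree (F (lchild v).1) (lchild v).2 = l.
  by rewrite /= -cats1 subtree_cat e /= subtree_nil.
have er : subtree (F (rchild v).1) (rchild v).2 = r.
  by rewrite /= -cats1 subtree_cat e /= subtree_nil.
have subl := sub_nodes_at el; have subr := sub_nodes_at er.
move: uq bl; rewrite nodes_atN /= -catA => /andP[vs uq] bl.
have vM : (rho F v <= rho_max F)%N.
  by rewrite -[v]/(val (SeqSub vF)) /rho_max; apply: leq_bigmax.
rewrite mulr_suml (big_geq_mkord _ _ xpredT) /=.
rewrite (big_ord_widen_cond (rho_max F).+1 _ 
  (fun k => w k * (tree_poly w id l (rho F v) k *
                   tree_poly w id r (rho F v + nleaves l)%N k.+1)
            * label_sum s G h)) // [RHS]big_mkcond /=.
apply: eq_bigr => k _; rewrite ltnS.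
pose c := if (b <= k <= rho F v)%N then w k else 0.
rewrite (@eq_label_sum _ _ _ _ _ _ (fun f => c *
   (weight w l (lchild v) k f * (weight w r (rchild v) k.+1 f * G f)))).
- rewrite label_sumZ IHl //.
  + have uqr : uniq (nodes_at r (rchild v) ++ s).
      by move: uq; rewrite cat_uniq => /and3P[].
    have blr u : u \in nodes_at r (rchild v) -> blind G u.
      by move=> ur; apply: bl; rewrite inE !mem_cat ur !orbT.
    have blv : blind G v by apply: bl; rewrite inE eqxx.
    rewrite IHr // (label_sum_blind _ blv).
    rewrite (rho_lchild e) (rho_rchild e) /c.
    by case: ifP => _; rewrite ?mul0r // !mulrA.
  + move=> u; rewrite mem_cat => /orP[/subr|/sub] //.
  + move=> u ul f j; rewrite bl ?inE ?mem_cat ?ul ?orbT //; congr (_ * _).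
    apply: blind_weight; first exact: subl.
    move: uq; rewrite cat_uniq => /and3P[_ /hasPn h' _].
    by apply/negP => ur; have := h' u; rewrite mem_cat ur ul => /(_ isT).
- by move=> u; rewrite !mem_cat => /or3P[/subl|/subr|/sub].
- move=> f ef; have fv : label f v = k.
    by rewrite ef // label_relabel // eqxx.
  rewrite fv /c; case: ifP => _; last by rewrite !mul0r.
  by rewrite !mulrA.
Qed.

Lemma forest_nodes_cons (F : For) k ks :
  [seq (k', p) | k' <- k :: ks, p <- internal (F k')] =
  nodes_at (F k) (k, [::]) ++ [seq (k', p) | k' <- ks, p <- internal (F k')].
Proof. by []. Qed.

Lemma label_sum_forest (A : comNzRingType) (w : nat -> A) (F : For) ks h :
  uniq ks ->
  label_sum [seq (k, p) | k <- ks, p <- internal (F k)]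
    (fun f => \prod_(k <- ks) @weight A w F (F k) (k, [::]) 1 f) h =
  \prod_(k <- ks) tree_poly w id (F k) (rho F (k, [::])) 1.
Proof.
move=> uq.
have sub ks' : {subset [seq (k, p) | k <- ks', p <- internal (F k)]
                  <= inodes F}.
  move=> u /allpairsPdep[k [p [_ pk ->]]].
  by rewrite mem_inodes -mem_internal.
have uqn ks' : uniq ks' -> uniq [seq (k, p) | k <- ks', p <- internal (F k)].
  move=> uq'; apply: allpairs_uniq_dep => //.
    by move=> k _; apply: uniq_internal.
  by move=> [k p] [k' p'] _ _ [-> ->].
elim: ks h uq => [|k ks IH] h uq; first by rewrite /= !big_nil.
have := uqn _ uq; rewrite !forest_nodes_cons => uqs; move: uq => /= /andP[kks uq].
rewrite (@eq_label_sum _ _ _ _ _ _ (fun f => @weight A w F (F k) (k, [::]) 1 f *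
   \prod_(k' <- ks) @weight A w F (F k') (k', [::]) 1 f)); first last.
- by move=> f _; rewrite big_cons.
- by rewrite -forest_nodes_cons; apply: sub.
rewrite label_sum_tree ?subtree_nil // ?IH ?big_cons // => u /mapP[p pk ->] f j.
apply: eq_big_seq => k' k's; apply: blind_weight.
  by rewrite mem_inodes -mem_internal.
by apply: contra kks => /mapP[p' _ [->]].
Qed.

(** Ranging over ambient nodes, this can be checked tree by tree along the list
    of nodes, unlike [compatible]. *)
Definition locally_compatible (F : For) (f : {ffun IN F -> 'I_(rho_max F).+1})
    (v : node) : bool :=
  [&& (0 < label f v <= rho F v)%N,
      (lchild v \in inodes F) ==> (label f v <= label f (lchild v))%N
    & (rchild v \in inodes F) ==> (label f v < label f (rchild v))%N].

Lemma compatibleE (F : For) (f : {ffun IN F -> 'I_(rho_max F).+1}) :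
  compatible (fun v => val (f v)) = all (locally_compatible f) (inodes F).
Proof.
have child (v : node) (rel : nat -> bool) :
    [forall w : IN F, (val w == v) ==> rel (f w)] =
    (v \in inodes F) ==> rel (label f v).
  apply/forallP/implyP => [h vF|h w].
    by have := h (SeqSub vF); rewrite eqxx -label_val.
  by apply/implyP => /eqP e; rewrite -label_val e h // -e ssvalP.
have locE (v : IN F) : locally_compatible f (val v) =
    [&& (0 < f v <= rho F (val v))%N,
      [forall w : IN F, (val w == lchild (val v)) ==> (f v <= f w)%N]
      & [forall w : IN F, (val w == rchild (val v)) ==> (f v < f w)%N]].
  by rewrite (child _ (leq (f v))) (child _ (ltn (f v))) /locally_compatible label_val.
apply/forallP/allP => [h u uF|h v]; last by rewrite -locE h // ssvalP.
by have := h (SeqSub uF); rewrite -locE.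
Qed.

(** The lower bounds handed to the children by [weight] are the edge conditions at
    their parent, and positivity of the labels follows from that of [b]. *)
Lemma weightE (A : comNzRingType) (w : nat -> A) (F : For) t v b f : (0 < b)%N ->
  subtree (F v.1) v.2 = t ->
  @weight A w F t v b f =
  if ((t != Leaf) ==> (b <= label f v)%N) && all (locally_compatible f) (nodes_at t v)
  then \prod_(u <- nodes_at t v) w (label f u) else 0.
Proof.
elim: t v b => [|l IHl r IHr] v b b0 e; first by rewrite /= big_nil.
have el : subtree (F (lchild v).1) (lchild v).2 = l.
  by rewrite /= -cats1 subtree_cat e /= subtree_nil.
have er : subtree (F (rchild v).1) (rchild v).2 = r.
  by rewrite /= -cats1 subtree_cat e /= subtree_nil.
rewrite nodes_atN big_cons big_cat /= all_cat {1}/locally_compatible !mem_inodes el er.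
case: (leqP b) => //= bv.
have v0 : (0 < label f v)%N by apply: leq_trans bv.
case: (leqP (label f v) (rho F v)) => [vr|_]; last by rewrite ?andbF.
rewrite IHl // IHr // v0 /=.
do 2 case: (_ ==> _) => //=; rewrite ?andbF ?mul0r ?mulr0 //.
by do 2 case: all => //=; rewrite ?mul0r ?mulr0.
Qed.

(** Compatibility never relates nodes of different trees. *)
Lemma forest_polyE (F : For) :
  forest_poly F = \prod_(k <- finsupp F) tree_poly x id (F k) (rho F (k, [::])) 1.
Proof.
rewrite -(label_sum_forest x [ffun=> ord0]) ?fset_uniq //.
rewrite (label_sum_all _ _ (uniq_inodes F)) /forest_poly big_mkcond /=.
apply: eq_bigr => f _; rewrite inE compatibleE.
have prodE (ks : seq nat) : \prod_(k <- ks) weight x (F k) (k, [::]) 1 f =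
    if all (locally_compatible f) [seq (k, p) | k <- ks, p <- internal (F k)]
    then \prod_(u <- [seq (k, p) | k <- ks, p <- internal (F k)]) x (label f u)
    else 0.
  elim: ks => [|k ks IH]; first by rewrite !big_nil.
  rewrite big_cons IH weightE ?subtree_nil // forest_nodes_cons all_cat big_cat /=.
  (* The lower bound 1 on the root is part of its own condition. *)
  have -> : ((F k != Leaf) ==> (0 < label f (k, [::]))%N) &&
      all (locally_compatible f) (nodes_at (F k) (k, [::])) =
      all (locally_compatible f) (nodes_at (F k) (k, [::])).
    case: (F k) => // l r; rewrite nodes_atN andb_idl //.
    by move=> /andP[/and3P[/andP[]]].
  by do 2 case: all; rewrite ?mul0r ?mulr0.
rewrite prodE; case: ifP => // _.
rewrite (perm_big [seq val v | v : IN F]) /=; last first.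
  apply: uniq_perm; rewrite ?uniq_inodes //.
    by rewrite map_inj_uniq ?enum_uniq //; apply: val_inj.
  move=> u; apply/idP/mapP => [uF|[v _ ->]]; last exact: ssvalP.
  by exists (SeqSub uF); rewrite ?mem_enum.
rewrite big_map big_enum; apply: eq_bigr => v _.
by rewrite label_val.
Qed.

(** * Trimming a forest *)

Lemma rho_root_lt (F : For) k l : (k < l)%N ->
  (rho F (k, [::]) + nleaves (F k) <= rho F (l, [::]))%N.
Proof.
rewrite !rho_root addnAC leq_add2r => lt.
rewrite -(big_ord_recr k (fun j => nleaves (F j))) /=.
rewrite -!(big_mkord xpredT (fun j => nleaves (F j))).
by rewrite [X in (_ <= X)%N](big_cat_nat (n := k.+1)) //= leq_addr.
Qed.

Lemma rho_terminal (F : For) k p : terminal F (k, p) ->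
  rho F (k, p) = (rho F (k, [::]) + index (rcons p false) (leaves (F k)))%N.
Proof.
by move=> /eqP e; rewrite rho_root /rho /leafnum /= e /= cats1 addnAC.
Qed.

Lemma terminal_at_rho (F : For) i k p : (rho F (k, [::]) <= i)%N ->
  terminal_at (F k) (i - rho F (k, [::])) = Some p <->
  terminal F (k, p) /\ rho F (k, p) = i.
Proof.
move=> le; split.
  move=> /terminal_atP[/eqP t e]; split=> //.
  by rewrite rho_terminal // e subnKC.
case=> t e; apply/terminal_atP; split; first exact/eqP.
by rewrite -e rho_terminal // addKn.
Qed.

Lemma terminal_inodes (F : For) v : terminal F v -> v \in inodes F.
Proof. by rewrite /terminal mem_inodes => /eqP->. Qed.

Lemma mem_LTer (F : For) v : terminal F v -> rho F v \in LTer F.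
Proof.
by move=> t; apply/mapP; exists v => //; rewrite mem_filter t terminal_inodes.
Qed.

Lemma trimE (F : For) v k : terminal F v ->
  trim F (rho F v) k = if k == v.1 then prune (F v.1) v.2 else F k.
Proof.
move=> t; rewrite /trim; case: pickP => [w /andP[tw /eqP rw]|].
  by rewrite (terminal_rho_inj tw t rw) fsfun_withE.
by move/(_ (SeqSub (terminal_inodes t))); rewrite /= t eqxx.
Qed.

(** Trimming may turn a tree into a leaf and thus shrink the support; this form
    lets both forests be written as products over the same trees. *)
Lemma forest_poly_incl (F : For) (K : {fset nat}) : (finsupp F `<=` K)%fset ->
  forest_poly F = \prod_(k <- K) tree_poly x id (F k) (rho F (k, [::])) 1.
Proof.
move=> sub; rewrite forest_polyE (big_fset_incl _ sub) // => k _.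
by rewrite memNfinsupp => /eqP->.
Qed.

Lemma R_forest_poly (F : For) i : (0 < i)%N -> R i (forest_poly F) =
  \prod_(k <- finsupp F) tree_poly x (squash i) (F k) (rho F (k, [::])) 1.
Proof.
move=> i0; rewrite forest_polyE rmorph_prod; apply: eq_bigr => k _.
rewrite (@rmorph_tree_poly _ _ (R i) x x i) //.
  by rewrite /squash ltnS i0.
by move=> j j0; rewrite /= /R peval_x.
Qed.

(** Trimming removes one leaf from the tree of [v], so exactly the trees after
    it are renumbered. *)
Lemma rho_trim_root (F : For) v k : terminal F v ->
  rho F (k, [::]) = (rho (trim F (rho F v)) (k, [::]) + (v.1 < k))%N.
Proof.
move=> t; rewrite !rho_root addnAC; congr (_ + _)%N.
have e := nleaves_prune (eqP t).
case: (ltnP v.1 k) => [lt|le]; last first.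
  rewrite addn0; apply: eq_bigr => j _; rewrite trimE //.
  by case: eqP => // jv; move: (ltn_ord j); rewrite jv ltnNge le.
rewrite (bigD1 (Ordinal lt)) // [in RHS](bigD1 (Ordinal lt)) //=.
rewrite trimE // eqxx e addSn addn1; congr (_ + _).+1.
by apply: eq_bigr => j; rewrite -val_eqE trimE // => /= /negbTE ->.
Qed.

Lemma T_eq i f g : R i.+1 f - R i f = x i * g -> T i f = g.
Proof. by move=> e; rewrite /T e divxK. Qed.

Theorem theorem6p1 (F : For) (i : nat) (i_gt0 : (0 < i)%N) :
  T i (forest_poly F) = if i \in LTer F then forest_poly (trim F i) else 0.
Proof.
have past (k : nat) : (i < rho F (k, [::]))%N ->
    tree_poly x (squash i.+1) (F k) (rho F (k, [::])) 1 =
    tree_poly x (squash i) (F k) (rho F (k, [::])) 1.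
  move=> lt; apply: eq_tree_poly => j _; rewrite /squash.
  by do 2 case: ifP; lia.
have same (k : nat) :
    (forall p, terminal F (k, p) -> rho F (k, p) <> i) ->
    tree_poly x (squash i.+1) (F k) (rho F (k, [::])) 1 =
    tree_poly x (squash i) (F k) (rho F (k, [::])) 1.
  move=> no; case: (ltnP i (rho F (k, [::]))) => [|le]; first exact: past.
  rewrite tree_poly_step //; case E: terminal_at => [p|]; last by rewrite addr0.
  by have [/no] := (terminal_at_rho p le).1 E.
apply: T_eq; rewrite !R_forest_poly //.
case: ifP => [/mapP[[k0 p]]|/negP no]; last first.
  rewrite mulr0; apply/eqP; rewrite subr_eq0; apply/eqP.
  apply: eq_bigr => k _; apply: same => q t e; apply: no.
  by rewrite -e; apply: mem_LTer.
rewrite mem_filter => /andP[t vF] ei.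
have le : (rho F (k0, [::]) <= i)%N.
  by rewrite ei (rho_terminal t) leq_addr.
have vS : k0 \in finsupp F.
  rewrite mem_finsupp; apply: contraTneq t => e.
  by rewrite /terminal e; case: (p).
rewrite (@forest_poly_incl _ (finsupp F)); last first.
  apply/fsubsetP => k; rewrite !mem_finsupp ei trimE //.
  by rewrite /=; case: (eqVneq k k0) => // ->; rewrite -mem_finsupp vS.
rewrite !(bigD1_seq _ vS) ?fset_uniq //=.
have at_v : terminal_at (F k0) (i - rho F (k0, [::])) = Some p.
  by apply/terminal_at_rho.
have root_v : rho (trim F i) (k0, [::]) = rho F (k0, [::]).
  by rewrite (rho_trim_root k0 t) ltnn addn0 ei.
have tree_v : trim F i k0 = prune (F k0) p by rewrite ei trimE // eqxx.
have past_v : (i < rho F (k0, [::]) + nleaves (F k0))%N.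
  rewrite ei (rho_terminal t) ltn_add2l index_mem.
  exact/mem_leaves_spine/eqP.
rewrite tree_poly_step // at_v root_v tree_v.
(* Both bounds squash i and squash i.+1 satisfy the hypotheses below, which
   mention the leaf i nowhere: only the tree k0 contains it. *)
have others (bnd : nat -> nat) : (forall j, (j < i)%N -> bnd j = j) ->
    (forall j, (i < j)%N -> bnd j = j.-1) ->
    \prod_(k <- finsupp F | k != k0)
       tree_poly x bnd (F k) (rho F (k, [::])) 1 =
    \prod_(k <- finsupp F | k != k0)
       tree_poly x id (trim F i k) (rho (trim F i) (k, [::])) 1.
  move=> lo hi; apply: eq_bigr => k kv.
  have -> : trim F i k = F k by rewrite ei trimE // (negbTE kv).
  have := rho_trim_root k t; rewrite -ei /= => e; apply: eq_tree_poly => j jk.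
  case: (ltngtP k k0) kv e => // lt _ e.
    rewrite lo /=; first by rewrite e addn0.
    by apply: leq_trans (leq_trans _ (rho_root_lt F lt)) le; rewrite ltn_add2l.
  rewrite hi /=; first by rewrite e addn1 addSn.
  apply: leq_trans past_v (leq_trans (rho_root_lt F lt) _).
  exact: leq_addr.
rewrite !others; first by rewrite mulrDl addrAC subrr add0r mulrA.
all: move=> j lt; rewrite /squash; case: ifP; lia.
Qed.
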